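(* Let $1\le L\le n$ be integers and $\alpha\in(0,1]$. For any arbitrary, but a-priori fixed, vector $\bm{x}\in\{0,1\}^n$ with exactly $L$ nonzero entries and any error exponent $\beta>0$, there exists a choice of parameters $(q,m,Z,d,\epsilon)$ such that, when the random contact matrix $\mathsf{M}^{(c)}\in\{0,1\}^{mZ\times n}$ is generated with i.i.d. Bernoulli$(q)$ entries and the tests are performed under the random-attack model with attack probability $\alpha$, the output $\hat{\bm{x}}$ of the $(d,\epsilon)$-threshold decoder satisfies $$\mathbb{P}[\hat{\bm{x}}\neq \bm{x}]\le n^{-\beta},$$ and the total number of tests satisfies $$mZ\le 450\,(1+\beta)\,\frac{L\log n}{\alpha}.$$
   Context: Notation: $[n]=\{1,\dots,n\}$; $\log$ is the natural logarithm. The set of unreliable workers is $\mathcal{L}=\{w\in[n]:\bm{x}_w=1\}$, so $|\mathcal{L}|=L$; the other workers are reliable. The vector $\bm{x}$ is deterministic. Parameters: $q=\theta/L$ for some $\theta\in[0,1]$, nonnegative integers $m$ (tests per time-slot) and $Z$ (number of time-slots in which tests are performed), and real numbers $d$ and $\epsilon$. Random-attack model: in each time-slot $z\in[Z]$, each unreliable worker is attacked with probability $\alpha$, independently of all other workers and time-slots. $\mathcal{L}_z\subseteq\mathcal{L}$ denotes the random set of workers attacked in time-slot $z$. Contact and sampling matrices: $\mathsf{M}^{(c)}\in\{0,1\}^{mZ\times n}$ has i.i.d. Bernoulli$(q)$ entries, independent of the attacks; worker $w$ is included in test $j$ iff $\mathsf{M}^{(c)}_{j,w}=1$. The tests of time-slot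 $z$ are the rows $\mathcal{T}_z=\{(z-1)m+1,\dots,zm\}$. The sampling matrix $\mathsf{M}^{(s)}$ is defined by $\mathsf{M}^{(s)}_{\mathcal{T}_z,w}=\mathsf{M}^{(c)}_{\mathcal{T}_z,w}$ if $w\in([n]\setminus\mathcal{L})\cup\mathcal{L}_z$, and $\mathsf{M}^{(s)}_{\mathcal{T}_z,w}=\mathbf{0}$ if $w\in\mathcal{L}\setminus\mathcal{L}_z$. The test results are $\bm{y}_j=\bigvee_{w=1}^n(\mathsf{M}^{(s)}_{j,w}\wedge\bm{x}_w)$; i.e. for $j\in\mathcal{T}_z$, $\bm{y}_j=1$ iff some $w\in\mathcal{L}_z$ has $\mathsf{M}^{(c)}_{j,w}=1$. For $a,b\in\{0,1\}$, $a\succ b$ means $(a,b)=(1,0)$, and $a\preceq b$ means not $a\succ b$; for binary vectors, $\preceq$ is entrywise. The $(d,\epsilon)$-threshold decoder: it observes $\mathsf{M}^{(c)}$ and $\bm{y}$. The score of worker $w$ in time-slot $z$ is $I_{w,z}=1$ if $\mathsf{M}^{(c)}_{\mathcal{T}_z,w}\preceq\bm{y}_{\mathcal{T}_z}$ and $\mathsf{M}^{(c)}_{\mathcal{T}_z,w}\ne\mathbf{0}$; $I_{w,z}=\epsilon$ if $\mathsf{M}^{(c)}_{\mathcal{T}_z,w}=\mathbf{0}$; $I_{w,z}=0$ if $\mathsf{M}^{(c)}_{\mathcal{T}_z,w}\not\preceq\bm{y}_{\mathcal{T}_z}$. The decoder outputs $\hat{\bm{x}}\in\{0,1\}^n$ with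 $\hat{\bm{x}}_w=1$ iff $I_w:=\sum_{z=1}^Z I_{w,z}\ge d$. *)

(* Defs.v *)
From HB Require Import structures.
From mathcomp Require Import all_boot all_order all_algebra.
From mathcomp Require Import reals exp bernoulli_distribution.
Set Implicit Arguments.
Unset Strict Implicit.
Unset Printing Implicit Defensive.
Import Order.TTheory GRing.Theory Num.Theory.
Local Open Scope ring_scope.

(* Workers are 'I_n, time-slots 'I_Z and tests 'I_(m * Z), all numbered from 0. *)

Definition unreliable (n : nat) (x : {ffun 'I_n -> bool}) : {set 'I_n} :=
  [set w | x w].

Lemma slot_subproof (m Z : nat) (j : 'I_(m * Z)) : (j %/ m < Z)%N.
Proof.
case: m j => [|m] j; first by case: j => j; rewrite mul0n.
by rewrite ltn_divLR // [X in (_ < X)%N]mulnC.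
Qed.

Definition slot (m Z : nat) (j : 'I_(m * Z)) : 'I_Z := Ordinal (slot_subproof j).

Definition tests_of (m Z : nat) (z : 'I_Z) : {set 'I_(m * Z)} :=
  [set j | slot j == z].

Definition sampling (n m Z : nat) (x : {ffun 'I_n -> bool})
    (Mc : 'M[bool]_(m * Z, n)) (att : {ffun 'I_Z -> {set 'I_n}}) :
    'M[bool]_(m * Z, n) :=
  \matrix_(j, w)
    (if w \in ~: unreliable x :|: att (slot j) then Mc j w else false).

Definition results (n m Z : nat) (x : {ffun 'I_n -> bool})
    (Ms : 'M[bool]_(m * Z, n)) : {ffun 'I_(m * Z) -> bool} :=
  [ffun j => [exists w, Ms j w && x w]].

Definition succb (a b : bool) : bool := a && ~~ b.
Definition preceqb (a b : bool) : bool := ~~ succb a b.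

(* A column M_{T_z,w} is zero in particular when m = 0. *)
Definition zero_col (n m Z : nat) (Mc : 'M[bool]_(m * Z, n))
    (w : 'I_n) (z : 'I_Z) : bool :=
  [forall (j | j \in tests_of m z), ~~ Mc j w].

Definition preceq_col (n m Z : nat) (Mc : 'M[bool]_(m * Z, n))
    (y : {ffun 'I_(m * Z) -> bool}) (w : 'I_n) (z : 'I_Z) : bool :=
  [forall (j | j \in tests_of m z), preceqb (Mc j w) (y j)].

Definition score (R : realType) (eps : R) (n m Z : nat)
    (Mc : 'M[bool]_(m * Z, n)) (y : {ffun 'I_(m * Z) -> bool})
    (w : 'I_n) (z : 'I_Z) : R :=
  if preceq_col Mc y w z && ~~ zero_col Mc w z then 1
  else if zero_col Mc w z then eps
  else 0.

Definition threshold_decoder (R : realType) (d eps : R) (n m Z : nat)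
    (Mc : 'M[bool]_(m * Z, n)) (y : {ffun 'I_(m * Z) -> bool}) :
    {ffun 'I_n -> bool} :=
  [ffun w => d <= \sum_(z < Z) score eps Mc y w z].

(* The randomness is a pair (contact matrix, attacked set of each slot); this
   is its joint probability mass function.  Reliable workers are attacked with
   probability 0, so att z \subset unreliable x almost surely. *)
Definition outcome (n m Z : nat) : finType :=
  ('M[bool]_(m * Z, n) * {ffun 'I_Z -> {set 'I_n}})%type.

Definition contact_pmf (R : realType) (q : R) (n m Z : nat)
    (Mc : 'M[bool]_(m * Z, n)) : R :=
  \prod_(j < m * Z) \prod_(w < n) bernoulli_pmf q (Mc j w).

Definition attack_pmf (R : realType) (alpha : R) (n Z : nat)
    (x : {ffun 'I_n -> bool}) (att : {ffun 'I_Z -> {set 'I_n}}) : R :=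
  \prod_(z < Z) \prod_(w < n)
    bernoulli_pmf (if w \in unreliable x then alpha else 0) (w \in att z).

Definition prob (R : realType) (q alpha : R) (n m Z : nat)
    (x : {ffun 'I_n -> bool}) (E : pred (outcome n m Z)) : R :=
  \sum_(o | E o) contact_pmf q o.1 * attack_pmf alpha x o.2.

Definition decoded (R : realType) (d eps : R) (n m Z : nat)
    (x : {ffun 'I_n -> bool}) (o : outcome n m Z) : {ffun 'I_n -> bool} :=
  threshold_decoder d eps o.1 (results x (sampling x o.1 o.2)).

Lemma bernoulli_pmf_sum (R : realType) (p : R) :
  \sum_(b : bool) bernoulli_pmf p b = 1.
Proof. by rewrite big_bool /bernoulli_pmf /= addrC subrK. Qed.

Lemma sum_contact_pmf (R : realType) (q : R) (n m Z : nat) :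
  \sum_(Mc : 'M[bool]_(m * Z, n)) contact_pmf q Mc = 1.
Proof.
pose G (f : {ffun 'I_(m * Z) * 'I_n -> bool}) : 'M[bool]_(m * Z, n) :=
  \matrix_(j, w) f (j, w).
have bijG : bijective G.
  exists (fun M : 'M[bool]_(m * Z, n) => [ffun p => M p.1 p.2]).
    by move=> f; apply/ffunP => -[j w]; rewrite ffunE mxE.
  by move=> M; apply/matrixP => j w; rewrite mxE ffunE.
rewrite (reindex G); last exact: onW_bij.
have E (f : {ffun 'I_(m * Z) * 'I_n -> bool}) :
    contact_pmf q (G f) = \prod_p bernoulli_pmf q (f p).
  rewrite /contact_pmf pair_bigA /=.
  by apply: eq_bigr => -[j w] _; rewrite mxE.
rewrite (eq_bigr _ (fun f _ => E f)) -(bigA_distr_bigA (fun _ => bernoulli_pmf q)).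
by rewrite big1 // => p _; rewrite bernoulli_pmf_sum.
Qed.

Lemma sum_attack_pmf (R : realType) (alpha : R) (n Z : nat)
    (x : {ffun 'I_n -> bool}) :
  \sum_(att : {ffun 'I_Z -> {set 'I_n}}) attack_pmf alpha x att = 1.
Proof.
pose p w := if w \in unreliable x then alpha else 0.
pose F (z : 'I_Z) (A : {set 'I_n}) := \prod_w bernoulli_pmf (p w) (w \in A).
rewrite -(bigA_distr_bigA F) big1 // => z _; rewrite /F.
pose S (f : {ffun 'I_n -> bool}) := [set w | f w].
have bijS : bijective S.
  exists (fun A : {set 'I_n} => [ffun w => w \in A]).
    by move=> f; apply/ffunP => w; rewrite ffunE inE.
  by move=> A; apply/setP => w; rewrite inE ffunE.
rewrite (reindex S); last exact: onW_bij.
have E (f : {ffun 'I_n -> bool}) :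
    \prod_w bernoulli_pmf (p w) (w \in S f) = \prod_w bernoulli_pmf (p w) (f w).
  by apply: eq_bigr => w _; rewrite inE.
rewrite (eq_bigr _ (fun f _ => E f)) -(bigA_distr_bigA (fun w => bernoulli_pmf (p w))).
by rewrite big1 // => w _; rewrite bernoulli_pmf_sum.
Qed.

Lemma prob_total (R : realType) (q alpha : R) (n m Z : nat)
    (x : {ffun 'I_n -> bool}) :
  prob q alpha x (fun _ : outcome n m Z => true) = 1.
Proof.
rewrite /prob -(pair_bigA _ (fun Mc att =>
  contact_pmf q Mc * attack_pmf alpha x att)) /=.
under eq_bigr => Mc _ do rewrite -mulr_sumr sum_attack_pmf mulr1.
exact: sum_contact_pmf.
Qed.

(* Main.v *)
(** Take one test per time-slot ([m = 1]), [eps = 0] and [q = 1 / (4 L)].  The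
    score of a worker is then the number of positive tests containing it.  In a
    single slot, a given unreliable worker is in a positive test with probability
    at least [q alpha], since it suffices that it is itself included and attacked;
    a reliable worker is so with probability at most [L q^2 alpha = q alpha / 4],
    by a union bound over the unreliable workers.  Slots are independent, so with
    [mu = Z q alpha] and [d = 3 mu / (8 ln 2)] the exponential Markov inequality
    applied to [2 ^ score] and [2 ^ (- score)] bounds the error probability of
    each worker by [exp (- mu / 8)], which is at most [n ^ (- (1 + beta))]. *)
Require Import Defs.
From HB Require Import structures.
From mathcomp Require Import all_boot all_order all_algebra.
From mathcomp Require Import reals exp bernoulli_distribution.
From mathcomp Require Import sequences ring lra.
Set Implicit Arguments.
Unset Strict Implicit.
Unset Printing Implicit Defensive.
Import Order.TTheory GRing.Theory Num.Theory.
Local Open Scope ring_scope.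

(** * Monotonicity and union bound for finite sums of nonnegative weights *)

Lemma ler_sum_pred (R : numDomainType) (I : finType) (P Q : pred I) (F : I -> R) :
  (forall i, 0 <= F i) -> {subset P <= Q} -> \sum_(i | P i) F i <= \sum_(i | Q i) F i.
Proof.
move=> F0 PQ; rewrite big_mkcond [leRHS]big_mkcond; apply: ler_sum => i _.
case: ifPn => [/PQ Qi|_]; last by case: ifP.
by rewrite -topredE /= in Qi; rewrite Qi.
Qed.

Lemma ler_sum_exists (R : numDomainType) (I J : finType) (P : pred J)
    (E : J -> pred I) (F : I -> R) :
  (forall i, 0 <= F i) ->
  \sum_(i | [exists (j | P j), E j i]) F i <= \sum_(j | P j) \sum_(i | E j i) F i.
Proof.
move=> F0; under [leRHS]eq_bigr => j _ do rewrite big_mkcond.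
rewrite exchange_big big_mkcond; apply: ler_sum => i _.
have G0 (j : J) : 0 <= (if E j i then F i else 0) by case: ifP.
case: ifPn => [/existsP[j /andP[Pj Eji]]|_]; last by apply: sumr_ge0.
by rewrite (bigD1 j) //= Eji lerDl sumr_ge0.
Qed.

(** * Finite product measures: marginals and exponential tail bounds *)

Section ProductMeasure.
Variables (R : realType) (I T : finType) (p : I -> T -> R).
Hypothesis p1 : forall i, \sum_t p i t = 1.

Lemma sum_prod1 : \sum_(f : {ffun I -> T}) \prod_i p i (f i) = 1.
Proof. by rewrite -bigA_distr_bigA big1 // => i _; rewrite p1. Qed.

(** Expanding the product of masked sums over all choice functions leaves only those [f] with every
    [E i (f i)]: any other [f] has a zero factor. *)
Lemma sum_prod_forall (E : I -> pred T) :
  \sum_(f : {ffun I -> T} | [forall i, E i (f i)]) \prod_i p i (f i)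
  = \prod_i \sum_(t | E i t) p i t.
Proof.
under [RHS]eq_bigr => i _ do rewrite big_mkcond.
rewrite bigA_distr_bigA big_mkcond; apply: eq_bigr => f _.
case: ifPn => [/forallP Ef|]; first by apply: eq_bigr => i _; rewrite Ef.
rewrite negb_forall => /existsP[i /negbTE Ei].
by rewrite (bigD1 i) //= Ei mul0r.
Qed.

Lemma sum_prod_marginal (i : I) (A : pred T) :
  \sum_(f : {ffun I -> T} | A (f i)) \prod_k p k (f k) = \sum_(t | A t) p i t.
Proof.
(* An event on one coordinate becomes a conjunction over all coordinates, trivial away from [i],
   where each factor sums to 1. *)
pose E k := if k == i then A else predT.
rewrite (eq_bigl (fun f : {ffun I -> T} => [forall k, E k (f k)])); last first.
  move=> f; apply/idP/forallP => [Ai k|/(_ i)]; rewrite /E ?eqxx //.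
  by case: eqP => [->|].
rewrite sum_prod_forall (bigD1 i) //= /E eqxx [X in _ * X]big1 ?mulr1 // => k /negbTE ->.
exact: p1.
Qed.

Lemma sum_prod_marginal2 (i j : I) (A B : pred T) : i != j ->
  \sum_(f : {ffun I -> T} | A (f i) && B (f j)) \prod_k p k (f k)
  = (\sum_(t | A t) p i t) * (\sum_(t | B t) p j t).
Proof.
move=> ij; pose E k := if k == i then A else if k == j then B else predT.
rewrite (eq_bigl (fun f : {ffun I -> T} => [forall k, E k (f k)])); last first.
  move=> f; apply/andP/forallP => [[Ai Bj] k|H].
    by rewrite /E; case: eqP => [->|_] //; case: eqP => [->|].
  by move: (H i) (H j); rewrite /E !eqxx eq_sym (negbTE ij).
rewrite sum_prod_forall (bigD1 i) //= (bigD1 j) 1?eq_sym //= mulrA /E !eqxx.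
rewrite [j == i]eq_sym (negbTE ij) [X in _ * X]big1 ?mulr1 //
  => k /andP[/negbTE -> /negbTE ->].
exact: p1.
Qed.

End ProductMeasure.

(** The indicator of the event is at most the exponential of [c] times (sum minus [d]), whose
    expectation factors over the slots; [1 + u <= expR u] bounds each factor. Keeping [c] on both
    sides of the event covers both tails: the upper one for [c > 0], the lower one for [c < 0]. *)
Lemma chernoff (R : realType) (T : finType) (P : T -> R) (h : pred T)
    (Z : nat) (c d : R) :
  (forall t, 0 <= P t) -> \sum_t P t = 1 ->
  \sum_(f : {ffun 'I_Z -> T} | c * d <= c * \sum_z (h (f z))%:R)
    \prod_z P (f z)
  <= expR (Z%:R * ((expR c - 1) * \sum_(t | h t) P t) - c * d).
Proof.
move=> P0 P1.
have mgf : \sum_t P t * expR (c * (h t)%:R)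
    = 1 + (expR c - 1) * \sum_(t | h t) P t.
  rewrite -[X in X + _]P1 mulr_sumr [X in _ = _ + X]big_mkcond -big_split /=.
  apply: eq_bigr => t _; case: (h t); rewrite /= ?mulr1; first by ring.
  by rewrite mulr0 expR0 mulr1 addr0.
have mgf_le : \sum_t P t * expR (c * (h t)%:R)
    <= expR ((expR c - 1) * \sum_(t | h t) P t).
  by rewrite mgf expR_ge1Dx.
apply: (@le_trans _ _ (\sum_(f : {ffun 'I_Z -> T})
    expR (- (c * d)) * \prod_z (P (f z) * expR (c * (h (f z))%:R)))).
  rewrite big_mkcond; apply: ler_sum => f _.
  have Pf : 0 <= \prod_z P (f z) by apply: prodr_ge0.
  rewrite big_split /= -expR_sum -mulr_sumr mulrCA -expRD.
  case: ifP => [le_cd|_]; last by rewrite mulr_ge0 ?expR_ge0.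
  apply: ler_peMr => //; apply: le_trans (expR_ge1Dx _).
  by rewrite lerDl addrC subr_ge0.
rewrite -mulr_sumr -(bigA_distr_bigA (fun _ t => P t * expR (c * (h t)%:R))).
rewrite prodr_const card_ord addrC expRD ler_wpM2l ?expR_ge0 //.
rewrite expRM_natl; apply: lerXn2r => //; rewrite nnegrE ?expR_ge0 //.
by apply: sumr_ge0 => t _; rewrite mulr_ge0 ?expR_ge0.
Qed.

(** * The model with one test per slot, as independent slots *)

Section OneTestPerSlot.
Variables (R : realType) (n Z : nat) (q alpha : R) (x : {ffun 'I_n -> bool}).
Hypotheses (q01 : 0 <= q <= 1) (alpha01 : 0 <= alpha <= 1).

Let attack_rate w : R := if w \in unreliable x then alpha else 0.

(* A slot records for each worker the pair (included in the test, attacked). *)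
Let slot_type := {ffun 'I_n -> bool * bool}.
Let worker_pmf w (b : bool * bool) : R :=
  bernoulli_pmf q b.1 * bernoulli_pmf (attack_rate w) b.2.
Let slot_pmf (a : slot_type) : R := \prod_w worker_pmf w (a w).

Lemma attack_rate01 w : 0 <= attack_rate w <= 1.
Proof. by rewrite /attack_rate; case: ifP => // _; rewrite lexx ler01. Qed.

Lemma worker_pmf_ge0 w b : 0 <= worker_pmf w b.
Proof. by rewrite mulr_ge0 // bernoulli_pmf_ge0 // attack_rate01. Qed.

Lemma sum_worker_pmf w : \sum_b worker_pmf w b = 1.
Proof.
rewrite -(pair_bigA _ (fun b c =>
  bernoulli_pmf q b * bernoulli_pmf (attack_rate w) c)) /=.
under eq_bigr => b _ do rewrite -mulr_sumr bernoulli_pmf_sum mulr1.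
exact: bernoulli_pmf_sum.
Qed.

Lemma sum_worker_pmf1 w : \sum_(b | b.1) worker_pmf w b = q.
Proof.
rewrite (eq_bigl (fun b => b.1 && predT b.2)); last by move=> b; rewrite andbT.
rewrite -(pair_big id predT (fun b c =>
  bernoulli_pmf q b * bernoulli_pmf (attack_rate w) c)) /=.
under eq_bigr => b _ do rewrite -mulr_sumr bernoulli_pmf_sum mulr1.
by rewrite big_mkcond big_bool /= addr0.
Qed.

Lemma sum_worker_pmf12 w : w \in unreliable x ->
  \sum_(b | b.1 && b.2) worker_pmf w b = q * alpha.
Proof.
move=> xw; rewrite -(pair_big id id (fun b c =>
  bernoulli_pmf q b * bernoulli_pmf (attack_rate w) c)) /=.
rewrite big_mkcond big_bool /= addr0 big_mkcond big_bool /= addr0.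
by rewrite /attack_rate xw.
Qed.

Lemma slot_pmf_ge0 a : 0 <= slot_pmf a.
Proof. by apply: prodr_ge0 => w _; apply: worker_pmf_ge0. Qed.

Lemma sum_slot_pmf : \sum_a slot_pmf a = 1.
Proof. exact: (sum_prod1 sum_worker_pmf). Qed.

(** The existential expresses that the slot's test is positive, so this is the event that [w] scores
    in the slot. *)
Let hit (w : 'I_n) (a : slot_type) : bool :=
  (a w).1 && [exists (v | v \in unreliable x), (a v).1 && (a v).2].

Lemma hit_unreliable w : w \in unreliable x ->
  q * alpha <= \sum_(a | hit w a) slot_pmf a.
Proof.
move=> xw; rewrite -(sum_worker_pmf12 xw).
rewrite -(sum_prod_marginal sum_worker_pmf w (fun b => b.1 && b.2)).
apply: ler_sum_pred => [a|a /andP[a1 a2]]; first exact: slot_pmf_ge0.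
by apply/andP; split=> //; apply/existsP; exists w; rewrite xw a1 a2.
Qed.

Lemma hit_reliable w : w \notin unreliable x ->
  \sum_(a | hit w a) slot_pmf a <= #|unreliable x|%:R * (q * (q * alpha)).
Proof.
move=> xw; pose E v (a : slot_type) := (a w).1 && ((a v).1 && (a v).2).
apply: (@le_trans _ _
    (\sum_(a | [exists (v | v \in unreliable x), E v a]) slot_pmf a)).
  apply: ler_sum_pred => [a|a /andP[a1 /existsP[v /andP[xv av]]]].
    exact: slot_pmf_ge0.
  by apply/existsP; exists v; rewrite xv /E a1.
apply: le_trans (ler_sum_exists _ _ slot_pmf_ge0) _.
rewrite mulr_natl -sumr_const; apply: ler_sum => v xv.
(* Since [w] is reliable, [v] differs from [w], so the two conditions concern distinct, hence
   independent, coordinates. *)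
rewrite (sum_prod_marginal2 sum_worker_pmf (i := w) (j := v) fst
  (fun b => b.1 && b.2)); last by apply: contraNneq xw => ->.
by rewrite sum_worker_pmf1 sum_worker_pmf12.
Qed.

(** A bijection preserving weights, through which probabilities of outcomes become sums over
    independent, identically distributed slots. *)
Let to_outcome (f : {ffun 'I_Z -> slot_type}) : outcome n 1 Z :=
  (\matrix_(j, w) (f (slot j) w).1, [ffun z => [set w | (f z w).2]]).

(** The inverse of [slot] when [m = 1]. *)
Let test_of (z : 'I_Z) : 'I_(1 * Z) := cast_ord (esym (mul1n Z)) z.

Lemma test_ofK : cancel test_of (@slot 1 Z).
Proof. by move=> z; apply: val_inj; rewrite /= divn1. Qed.

Lemma slot1K : cancel (@slot 1 Z) test_of.
Proof. by move=> j; apply: val_inj; rewrite /= divn1. Qed.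

Lemma to_outcome_bij : bijective to_outcome.
Proof.
exists (fun o : outcome n 1 Z =>
    [ffun z => [ffun w => (o.1 (test_of z) w, w \in o.2 z)]]).
  move=> f; apply/ffunP => z; apply/ffunP => w.
  by rewrite !ffunE mxE inE test_ofK -surjective_pairing.
case=> M A; congr pair; first by apply/matrixP => j w; rewrite mxE !ffunE slot1K.
by apply/ffunP => z; apply/setP => w; rewrite ffunE inE !ffunE.
Qed.

Lemma pmf_to_outcome f :
  contact_pmf q (to_outcome f).1 * attack_pmf alpha x (to_outcome f).2
  = \prod_z slot_pmf (f z).
Proof.
rewrite /contact_pmf (reindex test_of); last first.
  by apply: onW_bij; exists (@slot 1 Z); [exact: test_ofK|exact: slot1K].
rewrite -big_split /=; apply: eq_bigr => z _.
rewrite -big_split /=; apply: eq_bigr => w _.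
by rewrite /worker_pmf /attack_rate mxE ffunE !inE test_ofK.
Qed.

Lemma prob_slots (E : pred (outcome n 1 Z)) :
  prob q alpha x E = \sum_(f | E (to_outcome f)) \prod_z slot_pmf (f z).
Proof.
rewrite /prob (reindex to_outcome); last exact: onW_bij to_outcome_bij.
by apply: eq_bigr => f _; rewrite pmf_to_outcome.
Qed.

Lemma tests_of1 (z : 'I_Z) (P : pred 'I_(1 * Z)) :
  [forall (j | j \in tests_of 1 z), P j] = P (test_of z).
Proof.
apply/forallP/idP => [/(_ (test_of z))|Pz j]; first by rewrite inE test_ofK eqxx.
by rewrite inE; apply/implyP => /eqP jz; rewrite -(slot1K j) jz.
Qed.

(** With [eps = 0] an empty column scores the same as a violated one, so only inclusion in a
    positive test counts. *)
Lemma score_hit f w z :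
  score 0 (to_outcome f).1
    (results x (sampling x (to_outcome f).1 (to_outcome f).2)) w z
  = (hit w (f z))%:R :> R.
Proof.
rewrite /score /preceq_col /zero_col !tests_of1 ffunE mxE test_ofK.
set y := [exists _, _].
have -> : hit w (f z) = (f z w).1 && y.
  congr andb; apply: eq_existsb => v.
  rewrite !mxE /= !inE !ffunE test_ofK inE.
  by case: (x v); case: (f z v) => [[] []]; rewrite ?andbF.
by rewrite /preceqb /succb; case: (f z w).1; case: y.
Qed.

Lemma decoded_hit f (d : R) w :
  decoded d 0 x (to_outcome f) w = (d <= \sum_z (hit w (f z))%:R).
Proof.
by rewrite ffunE; congr (_ <= _); apply: eq_bigr => z _; apply: score_hit.
Qed.

Lemma prob_decoded_neq (mu d b : R) :
  mu = Z%:R * (q * alpha) -> #|unreliable x|%:R * q = 1 / 4%:R ->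
  ln 2%:R * d = 3%:R / 8%:R * mu -> expR (- (mu / 8%:R)) <= b ->
  prob q alpha x (fun o : outcome n 1 Z => decoded d 0 x o != x) <= n%:R * b.
Proof.
move=> muE Lq dE mub; rewrite prob_slots.
pose E w (f : {ffun 'I_Z -> slot_type}) := decoded d 0 x (to_outcome f) w != x w.
have P0 (f : {ffun 'I_Z -> slot_type}) : 0 <= \prod_z slot_pmf (f z).
  by apply: prodr_ge0 => z _; apply: slot_pmf_ge0.
apply: (@le_trans _ _
    (\sum_(f | [exists (w | predT w), E w f]) \prod_z slot_pmf (f z))).
  apply: ler_sum_pred => // f; apply: contraR => /existsPn H.
  by apply/eqP/ffunP => w; apply/eqP; rewrite -[_ == _]negbK H.
apply: le_trans (ler_sum_exists _ _ P0) _.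
rewrite mulr_natl -[X in b *+ X](card_ord n) -sumr_const.
apply: ler_sum => w _; apply: le_trans mub.
have le2 : 0 < ln (2%:R : R) by rewrite ln_gt0 // ltr1n.
have [xw|xw] := boolP (w \in unreliable x).
(* Lower tail with [c = - ln 2]: [expR c - 1 = - 1/2] and the mean score is at least [mu], so the
   exponent is at most [- mu/2 + 3 mu/8 = - mu/8]. *)
- apply: le_trans (_ : _ <= expR (Z%:R * ((expR (- ln 2%:R) - 1) *
      \sum_(a | hit w a) slot_pmf a) - (- ln 2%:R * d))) _.
    apply: le_trans (chernoff _ _ _ _ slot_pmf_ge0 sum_slot_pmf).
    apply: ler_sum_pred => // f; rewrite -!topredE /= /E decoded_hit.
    move: xw; rewrite inE => ->; rewrite eqb_id -ltNge => /ltW ltd.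
    by rewrite !mulNr lerN2 ler_pM2l.
  rewrite ler_expR expRN lnK ?posrE // mulNr dE.
  have := ler_wpM2l (ler0n R Z) (hit_unreliable xw); rewrite -muE.
  set s := \sum_(a | _) _; move: (Z%:R) => zz ?.
  have -> : zz * ((2%:R^-1 - 1) * s) = - (zz * s) / 2%:R by field.
  lra.
(* Upper tail with [c = ln 2]: [expR c - 1 = 1] and the mean score is at most [mu/4], so the
   exponent is at most [mu/4 - 3 mu/8 = - mu/8]. *)
- apply: le_trans (_ : _ <= expR (Z%:R * ((expR (ln 2%:R) - 1) *
      \sum_(a | hit w a) slot_pmf a) - (ln 2%:R * d))) _.
    apply: le_trans (chernoff _ _ _ _ slot_pmf_ge0 sum_slot_pmf).
    apply: ler_sum_pred => // f; rewrite -!topredE /= /E decoded_hit.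
    move: xw; rewrite inE => /negbTE ->; rewrite eqbF_neg negbK => led.
    by rewrite ler_pM2l.
  rewrite ler_expR lnK ?posrE // dE.
  have := ler_wpM2l (ler0n R Z) (hit_reliable xw).
  have -> : Z%:R * (#|unreliable x|%:R * (q * (q * alpha))) = mu / 4%:R.
    by rewrite [_%:R * (q * _)]mulrA Lq muE; field.
  set s := \sum_(a | _) _; move: (Z%:R) => zz ?.
  have -> : zz * ((2%:R - 1) * s) = zz * s by ring.
  lra.
Qed.

End OneTestPerSlot.

(** * Numerical choice of the parameters *)

Lemma ln2_ge_half (R : realType) : 1 / 2%:R <= ln (2%:R : R).
Proof.
rewrite -ler_expR lnK ?posrE //.
(* Inverting [1 - 1/2 <= expR (- 1/2)] gives [expR (1/2) <= 2]. *)
have := expR_ge1Dx (- (1 / 2%:R) : R); rewrite expRN => H.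
have e0 := expR_gt0 (1 / 2%:R : R).
rewrite -[leLHS]invrK -[leRHS]invrK lef_pV2 ?posrE ?invr_gt0 //; lra.
Qed.

Theorem theorem1 (R : realType) (n L : nat) (alpha : R)
  (hL1 : (1 <= L)%N) (hLn : (L <= n)%N)
  (halpha0 : 0 < alpha) (halpha1 : alpha <= 1)
  (x : {ffun 'I_n -> bool}) (hx : #|unreliable x| = L)
  (beta : R) (hbeta : 0 < beta) :
  exists (q : R) (m Z : nat) (d eps : R),
    [/\ exists2 theta : R, 0 <= theta <= 1 & q = theta / L%:R,
        prob q alpha x (fun o : outcome n m Z => decoded d eps x o != x)
          <= n%:R `^ (- beta)
      & (m * Z)%:R <= 450%:R * (1 + beta) * (L%:R * ln n%:R / alpha)].
Proof.
have L1 : (1 : R) <= L%:R by rewrite ler1n.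
have L0 : (0 : R) < L%:R by lra.
pose q : R := 1 / 4%:R / L%:R.
have q0 : 0 <= q by rewrite !divr_ge0 // ltW.
have q1 : q <= 1 by rewrite /q ler_pdivrMr //; lra.
have q01 : 0 <= q <= 1 by rewrite q0.
have a01 : 0 <= alpha <= 1 by rewrite ltW.
have hq : exists2 theta : R, 0 <= theta <= 1 & q = theta / L%:R.
  by exists (1 / 4%:R) => //; apply/andP; split; lra.
have n0 : (0 : R) < n%:R by rewrite ltr0n (leq_trans hL1).
pose K : R := (1 + beta) * ln n%:R.
pose B : R := 450%:R * (1 + beta) * (L%:R * ln n%:R / alpha).
have BE : B * (alpha / L%:R) = 450%:R * K by rewrite /B /K; field; lra.
(* For [n = 1] there are no tests and the error bound is [1]. *)
have K_eq0_or_ge : K = 0 \/ 1 / 2%:R <= K.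
  have [n1|n2] := leqP n 1; [left|right].
    have n_eq1 : n = 1%N by apply/eqP; rewrite eqn_leq n1 (leq_trans hL1).
    by rewrite /K [in ln _]n_eq1 ln1 mulr0.
  have : ln (2%:R : R) <= ln n%:R by rewrite ler_ln ?posrE // ler_nat.
  have := ln2_ge_half R; rewrite /K; nra.
have K0 : 0 <= K by case: K_eq0_or_ge; lra.
have aL0 : 0 < alpha / L%:R by rewrite divr_gt0.
have aL1 : alpha / L%:R <= 1 by rewrite ler_pdivrMr //; lra.
have B0 : 0 <= B by rewrite -(pmulr_lge0 _ aL0) BE; lra.
(* [B] is the test budget; rounding it down makes the bound on the number of tests immediate. *)
pose Z := Num.truncn B.
have /andP[ZB BZ] := truncn_itv B0.
have BZ' : B < Z%:R + 1 by rewrite natr1.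
pose mu : R := Z%:R * (q * alpha).
(* Rounding costs less than one slot, hence at most [alpha / L <= 1] in [4 mu]. So
   [4 mu >= 450 K - 1], which exceeds [32 K] once [K >= 1/2]; for [K = 0], [mu >= 0] suffices. *)
have muK : 8%:R * K <= mu.
  have -> : mu = Z%:R * (alpha / L%:R) / 4%:R by rewrite /mu /q; field; lra.
  have Zr0 : 0 <= Z%:R * (alpha / L%:R) by rewrite mulr_ge0 // ltW.
  have : B * (alpha / L%:R) <= (Z%:R + 1) * (alpha / L%:R).
    by rewrite ler_pM2r // ltW.
  by rewrite BE mulrDl mul1r; case: K_eq0_or_ge; lra.
exists q, 1%N, Z, (3%:R / 8%:R * mu / ln 2%:R), 0; split => //; last first.
  by rewrite mul1n.
have ln2 : ln (2%:R : R) != 0 by have := ln2_ge_half R; lra.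
(* The [1] in [1 + beta] pays for the factor [n] of the union bound over workers. *)
have -> : n%:R `^ (- beta) = n%:R * expR (- K).
  rewrite /powR gt_eqF // -[in X in _ = X * _](lnK (x := n%:R)) ?posrE //.
  by rewrite -expRD /K; congr expR; ring.
apply: (prob_decoded_neq q01 a01 (mu := mu)) => //.
- by rewrite hx /q; field; lra.
- by field.
- by rewrite ler_expR; lra.
Qed.
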